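(* Let $p\in(0,1]$, $h=p/(1+p)$, $\lambda>0$, and let $0<\rho<h$ be fixed. Consider, for each $n$, the TASEP-H process with I-perturbations on $n$ sites with $\rho n$ particles and parameter $\lambda$, and its scaled state descriptors $[f^n(\cdot,t),\tau^n(t)]$. Then, as $n\to\infty$, the sequence of the stationary distributions of $[f^n(\cdot,t),\tau^n(t)]$ is such that any subsequential limit of it is concentrated on the states with $\tau=0$ and finite number of clusters. In other words, $\tau^n(\infty)\Rightarrow 0$ in distribution (equivalently, $\mathbb{E}\,\tau^n(\infty)\to 0$), where $\tau^n(\infty)$ denotes $\tau^n$ in the stationary regime, and, consequently, the limiting flux (typical flux) is $\phi(\rho)=\lim_{n\to\infty}\phi(\rho,n)=\rho$.
   Context: Basic dynamics (TASEP-H). There are $n$ sites $0,1,\dots,n-1$ arranged in a circle (clockwise = ''right'') and a constant number $\rho n$ of particles (assumed an integer; otherwise use $\lceil\rho n\rceil$), at most one per site; empty sites are called holes. Time is discrete, $t=0,1,2,\dots$. Given the state at time $t$, the state at $t+1$ is obtained by applying to each particle simultaneously and independently: (a) if its right-neighbor site is occupied, it does not move; (b) if both neighbor sites are holes, it moves one site right with probability $1$; (c) if the right-neighbor site is a hole and the left-neighbor site is occupied, it moves one site right with probability $p$. A cluster is a maximal contiguous set of at least two particles. Perturbation. A perturbation of a state: a particle chosen uniformly at random is removed (its site immediately becoming a hole), and is then placed into one of the holes chosen uniformly at random (possibly the same site). I-perturbations model with parameter $\lambda>0$: at each time $t$, one perturbation is applied with probability $\lambda/n$, independently of the process history up to $t$;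 it is applied to the state after the normal particle movement at time $t$, takes no extra time, and the state at time $t$ is the state after movement and after the perturbation, if any. The process is a finite irreducible aperiodic Markov chain. Flux. For a state $\overline Z$, $\phi(\rho,n;\overline Z)=\psi(\rho,n;\overline Z)/n$, where $\psi(\rho,n;\overline Z)$ is the expected total distance traveled by all particles in the next time step when the current state is $\overline Z$ (a particle relocated by a perturbation is considered to travel clockwise to its new site). The flux is $\phi(\rho,n)=\mathbb{E}\,\phi(\rho,n;\overline Z(\infty))$ with $\overline Z(\infty)$ distributed according to the stationary distribution. The limiting (typical) flux is $\phi(\rho)=\lim_{n\to\infty}\phi(\rho,n)$, with $\rho,\lambda,p$ fixed. Scaled state. Space, time and particle numbers are divided by $n$; scaled time $t$ corresponds to unscaled time $\lfloor nt\rfloor$. Only increments of $f^n(\cdot,t)$ matter; in the standard version, $f^n(x,t)$ for $x\in[0,1)$ is $1/n$ times the number of particles in sites $1,\dots,\lfloor nx\rfloor$ (so $f^n(0,t)=0$), extended to $x\in\mathbb{R}$ by $f^n(x+1,t)=f^n(x,t)+\rho$. The quantity $\tau^n(t)$ is the sum over all clusters present at time $t$ of their scaled lengths, where the scaled length of a cluster is the (clockwise) distance from its leftmost to its rightmost particle divided by $n$, i.e. (number of its particles $-1$)$/n$; $\tau^n(t)=0$ if there are no clusters. The $f$-component is metrized by the sup-norm and the $\tau$-component by absolute value. *)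

(* Defs.v *)
From HB Require Import structures.
From mathcomp Require Import all_boot all_order all_algebra.
From mathcomp Require Import all_classical all_reals all_analysis.

Set Implicit Arguments.
Unset Strict Implicit.
Unset Printing Implicit Defensive.

Import Order.TTheory GRing.Theory Num.Theory.
Import numFieldNormedType.Exports.

Local Open Scope ring_scope.

(* A configuration on the ring of sites 0, ..., n-1 is the set of its occupied
   sites; the right (clockwise) neighbour of i is [ordS i], its left neighbour
   is [ord_pred i]. *)
Notation config n := {set 'I_n}.

(* Clockwise distance from i to j. *)
Definition cwdist (n : nat) (i j : 'I_n) : nat := ((j + n - i) %% n)%N.

Section Dynamics.
Context {R : realType} {n : nat}.
Variables (p lambda : R).
Implicit Types (A M : config n) (i j : 'I_n).

Definition jump_prob A i : R :=
  if ordS i \in A then 0 else if ord_pred i \in A then p else 1.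

(* Probability that M (a subset of A) is exactly the set of particles that
   move, the particles of A moving independently. *)
Definition move_prob A M : R :=
  \prod_(i in A) (if i \in M then jump_prob A i else 1 - jump_prob A i).

Definition moved A M : config n := (A :\: M) :|: [set ordS i | i in M].

Definition relocate A i j : config n := j |: (A :\ i).

(* Mean of h i j when i is a uniform particle of A and j is a uniform hole of
   A :\ i, the site i itself included. *)
Definition perturb_mean A (h : 'I_n -> 'I_n -> R) : R :=
  \sum_(i in A) \sum_(j in ~: (A :\ i))
    h i j / (#|A|%:R * #|~: (A :\ i)|%:R).

(* Mean over one time step from A of a quantity that depends on the set M of
   moving particles and on the perturbation: [None] if there is none, and
   [Some (i, j)] if the particle at i (after the movement) is sent to j.
   It is a probability average only if lambda <= n. *)
Definition step_mean A (h : config n -> option ('I_n * 'I_n) -> R) : R :=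
  \sum_(M : config n | M \subset A) move_prob A M *
    ((1 - lambda / n%:R) * h M None
     + lambda / n%:R * perturb_mean (moved A M) (fun i j => h M (Some (i, j)))).

Definition next A M (o : option ('I_n * 'I_n)) : config n :=
  if o is Some (i, j) then relocate (moved A M) i j else moved A M.

Definition travelled M (o : option ('I_n * 'I_n)) : nat :=
  (#|M| + if o is Some (i, j) then cwdist i j else 0)%N.

Definition transition A B : R := step_mean A (fun M o => (next A M o == B)%:R).

Definition psi A : R := step_mean A (fun M o => (travelled M o)%:R).

Definition stationary (k : nat) (nu : config n -> R) : Prop :=
  [/\ forall A, 0 <= nu A,
      forall A, #|A| != k -> nu A = 0,
      \sum_(A : config n) nu A = 1
    & forall B, nu B = \sum_(A : config n) nu A * transition A B].

Definition mean (nu : config n -> R) (h : config n -> R) : R :=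
  \sum_(A : config n) nu A * h A.

Definition flux (nu : config n -> R) : R := mean nu (fun A => psi A / n%:R).

End Dynamics.

Definition num_particles {R : realType} (rho : R) (n : nat) : nat :=
  `|Num.ceil (rho * n%:R)|%N.

Section ScaledState.
Context {R : realType} {n : nat}.
Implicit Type A : config n.

Definition contiguous (C : config n) : bool :=
  [exists i, C == [set j | (cwdist i j < #|C|)%N]].

Definition clusters A : {set config n} :=
  [set C | maxset (fun D => contiguous D && (D \subset A)) C & (1 < #|C|)%N].

Definition scaled_tau A : R := \sum_(C in clusters A) (#|C|.-1)%:R / n%:R.

(* Number of particles at sites 1, ..., floor(n x), over n, for x in [0, 1[,
   and f (x + 1) = f x + rho. *)
Definition scaled_f (rho : R) A (x : R) : R :=
  let k := Num.floor x in
  #|[set i in A | (0 < i <= Num.truncn (n%:R * (x - k%:~R)))%N]|%:R / n%:R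
  + rho * k%:~R.

(* The number of clusters is not a function of (f, tau) in the limit; it is
   kept as a coordinate in \bar R, +oo meaning infinitely many clusters. *)
Definition num_clusters A : \bar R := (#|clusters A|%:R)%:E.

End ScaledState.

Local Open Scope classical_set_scope.

(* Products of pointed topological spaces are pointed topological spaces. *)
HB.saturate prod.

(* The first factor consists of all functions on the line, with the topology of
   uniform convergence. *)
Definition state_space (R : realType) : ptopologicalType :=
  (arrow_uniform_type R R * R)%type.

Definition counted_state_space (R : realType) : ptopologicalType :=
  (state_space R * \bar R)%type.

Definition scaled_state {R : realType} (rho : R) (n : nat) (A : config n)
  : state_space R := (scaled_f rho A, scaled_tau A).

Definition counted_state {R : realType} (rho : R) (n : nat) (A : config n)
  : counted_state_space R := (scaled_state rho A, num_clusters A).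

Notation borelType X := (g_sigma_algebraType (@open X)).

(* Weak convergence to mu of the images under F of the laws nu n. *)
Definition cvg_in_law {R : realType} {X : ptopologicalType} (s : nat -> nat)
    (nu : forall n, config n -> R) (F : forall n, config n -> X)
    (mu : probability (borelType X) R) : Prop :=
  forall g : X -> R, continuous g -> (exists M, forall x, `|g x| <= M) ->
    mean (nu (s m)) (fun A => g (F (s m) A)) @[m --> \oo]
      --> Rintegral mu setT g.

(* Main.v *)
Require Import Defs.
From HB Require Import structures.
From mathcomp Require Import all_boot all_order all_algebra.
From mathcomp Require Import all_classical all_reals all_analysis.
From mathcomp Require Import measurable_realfun.
From mathcomp Require Import ring lra zify.

Set Implicit Arguments.
Unset Strict Implicit.
Unset Printing Implicit Defensive.

Import Order.TTheory GRing.Theory Num.Theory.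
Import numFieldNormedType.Exports.

Local Open Scope classical_set_scope.
Local Open Scope ring_scope.

(** Fix h strictly between rho and p / (1 + p).  For a starting site x let
    excess(x, L) be the number of particles in the L sites from x rightwards,
    minus h L, and let peak(x) >= 0 be its maximum over L.  In the frame moving
    with the free particles only the particles that do not move change place, by
    one site leftwards.  Such a move lowers peak at the site that a blocked
    particle leaves, and it can raise peak only at the front of a cluster; seen
    from x, the excess up to a given front performs a random walk with increments
    h (probability 1 - p) and 2 h - 1 (probability p), whose drift h (1 + p) - p
    is negative.  Hence, for small theta and large B,
    sum_x (peak(x) + B sum_fronts exp (theta (excess at the front - peak(x))))
    is a Lyapunov function: a step decreases its mean by at least the number of
    adjacent pairs of particles, up to the perturbations, which occur with
    probability lambda / n and cost O(n).  In the stationary regime the mean number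
    of adjacent pairs is therefore bounded uniformly in n; this number bounds
    n tau and the number of clusters, and controls the flux. *)

(** * Excess, peak and energy of a word *)

Section Words.
Context {R : realType}.
Variables (n : nat) (h theta : R).
Implicit Types (a b m z : nat -> bool) (L l : nat).

Definition excess a L : R := \sum_(l < L) ((a l)%:R - h).

Definition peak a : R := \big[Num.max/0]_(L < n.+1) excess a L.

(* The front particle itself is the letter [l.+1]. *)
Definition is_front a l := [&& a l, a l.+1 & ~~ a l.+2].

Definition weight a l : R := expR (theta * (excess a l.+2 - peak a)).

Definition energy a : R := \sum_(l < n | is_front a l) weight a l.

Lemma excessS a L : excess a L.+1 = excess a L + (a L)%:R - h.
Proof. by rewrite /excess big_ord_recr /= addrA. Qed.

Lemma excess0 a : excess a 0 = 0.
Proof. by rewrite /excess big_ord0. Qed.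

Lemma excess_le_peak a L : (L <= n)%N -> excess a L <= peak a.
Proof.
move=> Ln; rewrite -ltnS in Ln.
exact: (le_bigmax _ (fun L : 'I_n.+1 => excess a L) (Ordinal Ln)).
Qed.

Lemma peak_ge0 a : 0 <= peak a.
Proof. by rewrite -(excess0 a); exact: excess_le_peak. Qed.

Lemma peak_le a (u : R) :
  0 <= u -> (forall L, (L <= n)%N -> excess a L <= u) -> peak a <= u.
Proof. by move=> u0 ub; apply: bigmax_le => // -[L /= Ln] _; apply: ub. Qed.

Lemma weight_ge0 a l : 0 <= weight a l.
Proof. exact: expR_ge0. Qed.

Lemma energy_ge0 a : 0 <= energy a.
Proof. by apply: sumr_ge0 => l _; exact: weight_ge0. Qed.

(** Replaces periodicity when fronts are reindexed: along a full turn the weights do not repeat,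
    they only decrease. *)
Lemma sum_shift_le (T : nat -> R) :
  T n <= T 0%N -> \sum_(l < n) T l.+1 <= \sum_(l < n) T l.
Proof.
move=> Tn.
have : \sum_(l < n.+1) T l = \sum_(l < n.+1) T l by [].
rewrite {1}big_ord_recl big_ord_recr /=; under eq_bigr do rewrite /bump /=.
by lra.
Qed.

(* [a] is a configuration read rightwards from a site, [m] marks the particles
   that move, and [b] is the next configuration read from the next site: in this
   moving frame the particles of [m] stand still. *)
Section Step.
Variables a m b : nat -> bool.
Hypothesis n_gt0 : (0 < n)%N.
Hypothesis h01 : 0 <= h <= 2^-1.
Hypothesis theta01 : 0 <= theta <= 1.
Hypothesis periodic_a : forall l, a (l + n)%N = a l.
Hypothesis periodic_m : forall l, m (l + n)%N = m l.
Hypothesis density_a : excess a n <= 0.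
Hypothesis m_free : forall l, m l -> a l && ~~ a l.+1.
Hypothesis isolated_m : forall l, a l.+1 -> ~~ a l -> ~~ a l.+2 -> m l.+1.
Hypothesis bE : forall l, b l = m l || a l.+1 && ~~ m l.+1.

Lemma excess_addn L : excess a (L + n)%N <= excess a L.
Proof.
elim: L => [|L IH]; first by rewrite excess0.
by rewrite addSn !excessS periodic_a; lra.
Qed.

(** A full turn never increases the excess, by [density_a], so windows longer than [n] add nothing
    to the maximum. *)
Lemma excess_le_peak_periodic L : excess a L <= peak a.
Proof.
elim/ltn_ind: L => L IH; have [|ltnL] := leqP L n; first exact: excess_le_peak.
rewrite -(subnK (ltnW ltnL)); apply: le_trans (excess_addn _) _.
by apply: IH; lia.
Qed.

Let stays l := a l && ~~ m l.

(** Only staying particles change place, by one letter leftwards: letter [L] may enter the window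
    and letter 0 may leave it. *)
Lemma excess_step L : excess b L = excess a L + (stays L)%:R - (stays 0)%:R.
Proof.
elim: L => [|L IH]; first by rewrite !excess0; lra.
rewrite !excessS IH bE /stays.
have := @m_free L; case: (m L); case: (a L); case: (a L.+1); case: (m L.+1) => //=;
  by [move=> /(_ isT)|move=> _; lra].
Qed.

Lemma weight_addn l : weight a (l + n) <= weight a l.
Proof.
rewrite ler_expR ler_wpM2l //; first by case/andP: theta01.
by rewrite lerD2r -!addSn excess_addn.
Qed.

Lemma is_front_addn l : is_front a (l + n) = is_front a l.
Proof. by rewrite /is_front -!addSn !periodic_a. Qed.

(** A blocked particle at letter 0 leaves every window. A staying particle that enters at the right
    end can push the excess above [peak a] only if it is a front, and then by at most its weight. *)
Lemma peak_step : peak b <= peak a + energy a - (a 0 && a 1)%:R.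
Proof.
have E0 := energy_ge0 a; have P0 := peak_ge0 a.
have leP := excess_le_peak_periodic.
(* Covers the empty window, whose excess stays 0: two adjacent particles already give a peak of at
   least 2 - 2h >= 1. *)
have block2 : (a 0 && a 1)%:R <= peak a.
  case: (boolP (a 0 && a 1)) => [/andP[a0 a1]|_]; last exact: P0.
  have := leP 2; rewrite !excessS excess0 a0 a1 /=.
  by move: h01 => /andP[]; lra.
apply: peak_le => [|L Ln]; first by lra.
rewrite excess_step.
have stays01 : ((a 0 && a 1)%:R : R) <= (stays 0)%:R.
  rewrite ler_nat /stays; case: (boolP (a 0 && a 1)) => // /andP[a0 a1].
  by rewrite a0 /= lt0b; apply/negP => /m_free; rewrite a1 andbF.
case: L Ln => [_|L Ln]; first by rewrite excess0; lra.
suff: excess a L.+1 + (stays L.+1)%:R <= peak a + energy a by lra.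
case: (boolP (stays L.+1)) => [/andP[aL mL]|_]; last by have := leP L.+1; rewrite /=; lra.
(* If the next letter is occupied too, the window longer by two letters has gained 2 - 2h >= 1, so
   the entering particle is already accounted for. *)
case: (boolP (a L.+2)) => aL2.
  have := leP L.+3; rewrite !excessS aL aL2 /=.
  by move: h01 => /andP[]; lra.
have aL0 : a L by apply: contraNT mL => aL0; exact: isolated_m.
have Lfront : is_front a L by rewrite /is_front aL0 aL aL2.
have wE : weight a L <= energy a.
  rewrite /energy (bigD1 (Ordinal Ln)) //= lerDl.
  by apply: sumr_ge0 => l _; exact: weight_ge0.
suff: excess a L.+1 + 1 <= peak a + weight a L by rewrite /=; lra.
(* With u the excess up to the front and P the peak, exp y >= 1 + y reduces u + h <= P + weight to
   (1 - theta)(P - u) + 1 - h >= 0. *)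
have := expR_ge1Dx (theta * (excess a L.+2 - peak a)); rewrite -/(weight a L).
have := leP L.+2; rewrite [excess a L.+2]excessS aL.
move: h01 theta01 => /andP[h0 h1] /andP[t0 t1] /=.
set u := (excess a L.+1 + 1 - h) => u0 wu.
have : 0 <= (1 - theta) * (peak a - u) by rewrite mulr_ge0; lra.
by move: wu; rewrite /u; lra.
Qed.

Lemma peak_step_ge : peak a - (stays 0)%:R <= peak b.
Proof.
rewrite lerBlDr; apply: peak_le => [|L Ln]; first by rewrite addr_ge0 ?peak_ge0.
have := excess_le_peak b Ln; rewrite excess_step.
have : 0 <= ((stays L)%:R : R) by []; lra.
Qed.

(** Exponentials of theta times the increments of the excess at a front: 2h - 1 if the front
    particle moves off and the one behind takes over, h if it stays. *)
Definition front_factor (moves : bool) : R :=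
  if moves then expR (- theta * (1 - 2 * h)) else expR (theta * h).

(** No front arises from nothing: the front particle of [b] is a staying particle of [a], either a
    front already or directly behind a front that moves. The loss [stays 0] in the excess is offset
    by [peak_step_ge]. *)
Lemma energy_step :
  energy b <= \sum_(l < n | is_front a l) weight a l * front_factor (m l.+1).
Proof.
(* A front of [b] at [l] will be charged to [T true l.+2] or to [T false l.+1]; shifting the index
   costs nothing. *)
pose T c l : R := (is_front a l && (m l.+1 == c))%:R * (weight a l * front_factor c).
have T_shift c k : \sum_(l < n) T c (l.+1 + k)%N <= \sum_(l < n) T c (l + k)%N.
  apply: (sum_shift_le (T := fun l => T c (l + k)%N)); rewrite add0n addnC /T.
  rewrite is_front_addn -addSn periodic_m ler_wpM2l //.
  by rewrite ler_wpM2r ?weight_addn // /front_factor; case: c; exact: expR_ge0.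
have -> : \sum_(l < n | is_front a l) weight a l * front_factor (m l.+1) =
    \sum_(l < n) T false l + \sum_(l < n) T true l.
  rewrite -big_split big_mkcond /=; apply: eq_bigr => l _; rewrite /T.
  by case: (is_front a l); case: (m l.+1); rewrite /=; ring.
have Tt : \sum_(l < n) T true l.+2 <= \sum_(l < n) T true l.
  have := T_shift true 0%N; have := T_shift true 1%N.
  under eq_bigr do rewrite addn1.
  under [X in _ <= X -> _]eq_bigr do rewrite addn1.
  under [X in _ -> X <= _ -> _]eq_bigr do rewrite addn0.
  under [X in _ -> _ <= X -> _]eq_bigr do rewrite addn0.
  exact: le_trans.
have Tf : \sum_(l < n) T false l.+1 <= \sum_(l < n) T false l.
  have := T_shift false 0%N.
  under eq_bigr do rewrite addn0.
  by under [X in _ <= X -> _]eq_bigr do rewrite addn0.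
apply: le_trans (lerD Tf Tt); rewrite -big_split /=.
rewrite /energy big_mkcond; apply: ler_sum => l _ /=.
have T_ge0 c i : 0 <= T c i.
  by rewrite !mulr_ge0 ?weight_ge0 // /front_factor; case: c; exact: expR_ge0.
case: ifP => [|_]; last by rewrite addr_ge0.
case/and3P; rewrite !bE !negb_or !negb_and !negbK.
have peak_ge := peak_step_ge.
have weight_step i (e : R) : excess b l.+2 <= excess a i.+2 + e - (stays 0)%:R ->
    weight b l <= weight a i * expR (theta * e).
  move=> leE; rewrite /weight -expRD ler_expR -mulrDr ler_wpM2l //.
    by case/andP: theta01.
  by lra.
move=> bl bl1 /andP[ml2 ml3].
(* If letter [l.+1] of [b] came from a moving particle of [a], letter [l] of [b] would be empty. *)
have stays_l2 : stays l.+2.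
  rewrite /stays; case/orP: bl1 => // ml1.
  by case/orP: bl => [/m_free|/andP[_ /negP//]]; have := m_free ml1 => /andP[-> _] /andP[].
have [al2 ml2'] := andP stays_l2.
(* If occupied, letter [l.+3] is a front that moves off and exposes [l.+2]; otherwise [l.+2] is
   itself a front that stays. *)
case: (boolP (a l.+3)) => al3.
  have ml3' : m l.+3 by move: ml3; rewrite al3.
  have al4 : ~~ a l.+4 by case/andP: (m_free ml3').
  have /= := @weight_step l.+2 (2 * h - 1); rewrite excess_step !excessS al2 al3 stays_l2 /=.
  move=> /(_ ltac:(lra)) /le_trans; apply.
  apply: le_trans (_ : _ <= T true l.+2) _; last by rewrite lerDr.
  rewrite /T /is_front al2 al3 al4 ml3' /= mul1r ler_wpM2l ?weight_ge0 //.
  by rewrite /front_factor ler_expR; lra.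
have al1 : a l.+1 by apply: contraNT ml2' => al1; exact: isolated_m.
have /= := @weight_step l.+1 h; rewrite excess_step !excessS al2 stays_l2 /=.
move=> /(_ ltac:(lra)) /le_trans; apply.
apply: le_trans (_ : _ <= T false l.+1) _; last by rewrite lerDl.
by rewrite /T /is_front al1 al2 al3 (negbTE ml2') /= mul1r.
Qed.

End Step.

(** * Effect of one relocation on peak and energy *)

Section Perturbation.
Variables a b z : nat -> bool.
Hypothesis h01 : 0 <= h <= 2^-1.
Hypothesis theta01 : 0 <= theta <= 1.
Hypothesis away : forall l, ~~ z l -> b l = a l.
Hypothesis few : forall k, (\sum_(l < n) z (k + l) <= 2)%N.

(** At most two letters change per turn, and the window of length [n.+1], used by the weight at
    [l = n - 1], may contain one more. *)
Lemma excess_perturb L : (L <= n.+1)%N -> `|excess b L - excess a L| <= 3.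
Proof.
move=> Ln; apply: (@le_trans _ _ (\sum_(l < L) z l)%:R).
  rewrite /excess -sumrB natr_sum; apply: le_trans (ler_norm_sum _ _ _) _.
  apply: ler_sum => l _; have := @away l.
  case: (z l) => [_|/(_ isT) ->]; last by rewrite subrr normr0.
  by case: (a l); case: (b l); rewrite ler_norml /=; lra.
rewrite (ler_nat _ _ 3).
apply: (@leq_trans (\sum_(l < n.+1) z l)).
  by rewrite -!(big_mkord xpredT (fun l => z l : nat)) (@big_cat_nat _ _ _ L 0 n.+1) //= leq_addr.
have few0 : (\sum_(l < n) z l <= 2)%N := few 0.
by rewrite big_ord_recr /= -[3%N]/(2 + 1)%N leq_add // leq_b1.
Qed.

Lemma peak_perturb : `|peak b - peak a| <= 3.
Proof.
rewrite ler_norml; apply/andP; split.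
  rewrite lerBrDl lerBlDr; apply: peak_le.
    by rewrite addr_ge0 ?peak_ge0.
  move=> L Ln; have := excess_perturb (leqW Ln); have := excess_le_peak b Ln.
  by rewrite ler_norml => ? /andP[]; lra.
rewrite lerBlDr; apply: peak_le; first by rewrite addr_ge0 ?peak_ge0.
move=> L Ln; have := excess_perturb (leqW Ln); have := excess_le_peak a Ln.
by rewrite ler_norml => ? /andP[]; lra.
Qed.

(** Away from the changed letters fronts are the same, and their weights grow by at most exp (6
    theta): 3 from the excess, 3 from the peak. At most 6 indices see a changed letter among their
    three. *)
Lemma energy_perturb :
  energy b <= expR (6 * theta) * energy a + 6 * expR theta.
Proof.
have /andP[t0 t1] := theta01; have /andP[h0 h1] := h01.
pose D (l : nat) : R := (z l + z l.+1 + z l.+2)%:R.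
have D6 : \sum_(l < n) D l <= 6.
  rewrite -natr_sum (ler_nat _ _ 6) !big_split /=.
  have few0 : (\sum_(l < n) z l <= 2)%N := few 0.
  have few1 : (\sum_(l < n) z l.+1 <= 2)%N := few 1.
  have few2 : (\sum_(l < n) z l.+2 <= 2)%N := few 2.
  by rewrite -[6%N]/(2 + 2 + 2)%N !leq_add.
have leD l : (l < n)%N -> (is_front b l)%:R * weight b l <=
    expR (6 * theta) * ((is_front a l)%:R * weight a l) + expR theta * D l.
  (* The bound is exp theta, not 1, because the window [l.+2] may exceed the range of the peak by
     one letter. *)
  move=> ln; have wb : weight b l <= expR theta.
    rewrite ler_expR -[leRHS]mulr1 ler_wpM2l //.
    have : excess b l.+2 <= excess b l.+1 + 1.
      by rewrite [excess b l.+2]excessS; case: (b l.+1) => /=; lra.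
    have := excess_le_peak b ln; lra.
  have wab : weight b l <= expR (6 * theta) * weight a l.
    rewrite -expRD ler_expR [6 * theta]mulrC -mulrDr ler_wpM2l //.
    have := excess_perturb (ln : (l.+2 <= n.+1)%N); have := peak_perturb.
    by rewrite !ler_norml => /andP[? ?] /andP[? ?]; lra.
  have w0 := weight_ge0 b l; have := expR_ge0 theta; have := expR_ge0 (6 * theta).
  move=> e6 e1; have wa0 := weight_ge0 a l.
  case: (posnP (z l + z l.+1 + z l.+2)) => [D0|Dpos].
    have -> : is_front b l = is_front a l.
      have nz k : z k = false -> b k = a k by move=> zk; apply: away; rewrite zk.
      by rewrite /is_front !nz //; case: (z l) (z l.+1) (z l.+2) D0 => [] [] [].
    rewrite /D D0 mulr0 addr0; case: (is_front a l); rewrite /= ?mul1r ?mul0r ?mulr0 //.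
  apply: (@le_trans _ _ (expR theta * 1)).
    by case: (is_front b l); rewrite /= ?mul1r ?mul0r mulr1.
  apply: (@le_trans _ _ (expR theta * D l)); first by rewrite ler_wpM2l // /D (ler_nat _ 1).
  by rewrite lerDr !mulr_ge0.
have energyE c : energy c = \sum_(l < n) (is_front c l)%:R * weight c l.
  by rewrite /energy big_mkcond; apply: eq_bigr => l _; case: is_front => /=; lra.
rewrite !energyE mulr_sumr.
apply: (@le_trans _ _ (\sum_(l < n)
  (expR (6 * theta) * ((is_front a l)%:R * weight a l) + expR theta * D l))).
  by apply: ler_sum => l _; exact: leD.
by rewrite big_split /= lerD2l -mulr_sumr mulrC ler_wpM2r ?expR_ge0.
Qed.

End Perturbation.
End Words.

(** * Words read on the ring, and the law of one step *)

Section Ring.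
Context {R : realType} {n : nat}.
Implicit Types (A M : config n) (x i j : 'I_n).

Definition word A x l : bool := iter l (@ordS n) x \in A.

Definition blocked A : config n := [set i in A | ordS i \in A].

Lemma val_iter_ordS x l : iter l (@ordS n) x = ((x + l) %% n)%N :> nat.
Proof.
elim: l => [|l IH]; first by rewrite addn0 modn_small.
by rewrite iterS /= IH -addn1 modnDml addn1 addnS.
Qed.

Lemma iter_ordSn x : iter n (@ordS n) x = x.
Proof. by apply: val_inj; rewrite /= val_iter_ordS modnDr modn_small. Qed.

Lemma iter_ordS_inj x : injective (fun l : 'I_n => iter l (@ordS n) x).
Proof.
move=> l k /(congr1 val); rewrite /= !val_iter_ordS => /eqP.
by rewrite eqn_modDl !modn_small // => /eqP /val_inj.
Qed.

Lemma word_addn A x l : word A x (l + n)%N = word A x l.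
Proof. by rewrite /word iterD iter_ordSn. Qed.

Lemma excess_word (h : R) A x : excess h (word A x) n = #|A|%:R - h * n%:R.
Proof.
rewrite /excess sumrB sumr_const card_ord -[h *+ n]mulr_natr; congr (_ - _).
rewrite -natr_sum; congr (_%:R); rewrite -sum1_card [RHS]big_mkcond /=.
rewrite [RHS](reindex_inj (@iter_ordS_inj x)) /=.
by apply: eq_bigr => l _; rewrite /word; case: (_ \in _).
Qed.

Lemma sum_hits x i j k :
  (\sum_(l < n) ((iter (k + l) (@ordS n) x == i) || (iter (k + l) (@ordS n) x == j))
    <= 2)%N.
Proof.
have hit1 y : (\sum_(l < n) (iter (k + l) (@ordS n) x == y) <= 1)%N.
  under eq_bigr do rewrite addnC iterD.
  have -> : (\sum_(l < n) (iter l (@ordS n) (iter k (@ordS n) x) == y) =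
      \sum_u (u == y))%N by rewrite [RHS](reindex_inj (@iter_ordS_inj (iter k (@ordS n) x))).
  by rewrite -big_mkcond /= sum1_card card1.
apply: leq_trans (leq_add (hit1 i) (hit1 j)); rewrite -big_split /=.
by apply: leq_sum => l _; do 2 case: (_ == _).
Qed.

Section Support.
Variables (p : R) (A M : config n).
Hypotheses (MA : M \subset A) (prob_neq0 : move_prob p A M != 0).

Lemma support_free i : i \in M -> ordS i \notin A.
Proof.
move=> iM; apply: contraNN prob_neq0 => iA.
by rewrite /move_prob (bigD1 i (fintype.subsetP MA _ iM)) /= iM /jump_prob iA mul0r.
Qed.

Lemma support_isolated i :
  i \in A -> ordS i \notin A -> ord_pred i \notin A -> i \in M.
Proof.
move=> iA Si Pi; apply: contraNT prob_neq0 => iM.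
by rewrite /move_prob (bigD1 i iA) /= (negbTE iM) /jump_prob (negbTE Si) (negbTE Pi) subrr mul0r.
Qed.

(** Provides the hypothesis [bE]: reading from the next site makes the moving particles stand
    still. *)
Lemma word_moved x l :
  word (moved A M) (ordS x) l =
  word M x l || word A x l.+1 && ~~ word M x l.+1.
Proof.
rewrite /word -iterSr /moved !inE [in RHS]orbC andbC; congr (_ || _).
by rewrite iterS mem_imset //; exact: ordS_inj.
Qed.

End Support.

(** The distributive law over all sites, with [F] replaced by 0 and [G] by 1 outside [A], keeps only
    the subsets of [A]. *)
Lemma sum_prod_subset A (F G : 'I_n -> R) :
  \sum_(M : config n | M \subset A) \prod_(i in A) (if i \in M then F i else G i)
  = \prod_(i in A) (F i + G i).
Proof.
pose F' i := if i \in A then F i else 0; pose G' i := if i \in A then G i else 1.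
transitivity (\prod_i (F' i + G' i)); last first.
  by rewrite [RHS]big_mkcond; apply: eq_bigr => i _; rewrite /F' /G'; case: ifP; rewrite ?add0r.
rewrite bigA_distr big_mkcond; apply: eq_big => // M _.
case: ifP => [MA|/negbT/fintype.subsetPn[i iM iA]].
  rewrite big_mkcond; apply: eq_bigr => i _; rewrite /F' /G'.
  by case: ifP => [//|iA]; case: ifP => // /(fintype.subsetP MA); rewrite iA.
by rewrite (bigD1 i) //= iM /F' (negbTE iA) mul0r.
Qed.

Lemma sum_move_prob (p : R) A : \sum_(M : config n | M \subset A) move_prob p A M = 1.
Proof.
by rewrite sum_prod_subset big1 // => i _; rewrite addrCA subrr addr0.
Qed.

(** By independence [g] is absorbed into the factor of [i], and every other factor sums to 1. *)
Lemma move_prob_marginal (p : R) A i (g : bool -> R) : i \in A ->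
  \sum_(M : config n | M \subset A) move_prob p A M * g (i \in M) =
  jump_prob p A i * g true + (1 - jump_prob p A i) * g false.
Proof.
move=> iA; pose q := jump_prob p A.
pose F k := q k * (if k == i then g true else 1).
pose G k := (1 - q k) * (if k == i then g false else 1).
transitivity (\sum_(M : config n | M \subset A)
    \prod_(k in A) (if k \in M then F k else G k)).
  apply: eq_bigr => M _; rewrite /move_prob (bigD1 i iA) [RHS](bigD1 i iA) /=.
  rewrite /F /G eqxx mulrAC; congr (_ * _).
    by case: ifP.
  by apply: eq_bigr => k /andP[_ /negbTE ->]; rewrite !mulr1.
rewrite sum_prod_subset (bigD1 i iA) /= /F /G eqxx big1 ?mulr1 // => k /andP[_ /negbTE ->].
by rewrite !mulr1 addrCA subrr addr0.
Qed.

Lemma move_prob_ge0 (p : R) A M : 0 <= p <= 1 -> 0 <= move_prob p A M.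
Proof.
move=> /andP[p0 p1]; apply: prodr_ge0 => i _; rewrite /jump_prob.
by case: (i \in M); case: (ordS i \in A); case: (ord_pred i \in A); rewrite ?subr_ge0 ?subr0 ?subrr.
Qed.

(** The weights sum to 1, or to 0 when [A] is empty; the latter case is why [c] is nonnegative. *)
Lemma perturb_mean_le A (f : 'I_n -> 'I_n -> R) (c : R) :
  0 <= c -> (forall i j, f i j <= c) -> perturb_mean A f <= c.
Proof.
move=> c0 fc; apply: (@le_trans _ _ (\sum_(i in A) c / #|A|%:R)).
  apply: ler_sum => i _.
  apply: (@le_trans _ _ (\sum_(j in ~: (A :\ i)) c / (#|A|%:R * #|~: (A :\ i)|%:R))).
    by apply: ler_sum => j _; rewrite ler_wpM2r // invr_ge0 mulr_ge0.
  rewrite sumr_const; have [->|] := posnP #|~: (A :\ i)|.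
    by rewrite mulr0n divr_ge0.
  rewrite -(ltr0n R) => H0; rewrite -[leLHS]mulr_natr invfM mulrA divfK ?gt_eqF //.
rewrite sumr_const; have [->|] := posnP #|A|; first by rewrite mulr0n.
by rewrite -(ltr0n R) => A0; rewrite -[leLHS]mulr_natr divfK ?gt_eqF //.
Qed.

Lemma perturb_mean_ge0 A (f : 'I_n -> 'I_n -> R) :
  (forall i j, 0 <= f i j) -> 0 <= perturb_mean A f.
Proof.
by move=> f0; do 2 apply: sumr_ge0 => ? _; rewrite divr_ge0 // mulr_ge0.
Qed.

End Ring.

(** * Drift of the Lyapunov function *)

Section Drift.
Context {R : realType} {n : nat}.
Variables (p h theta : R).
Implicit Types (A M : config n) (x i j : 'I_n).

Definition total_peak A : R := \sum_x peak n h (word A x).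

Definition total_energy A : R := \sum_x energy n h theta (word A x).

Definition lyapunov (B : R) A : R := total_peak A + B * total_energy A.

(** Mean of [front_factor]: a front has an occupied left neighbour and an empty right one, so it
    moves with probability p. *)
Definition decay : R :=
  p * front_factor h theta true + (1 - p) * front_factor h theta false.

Hypothesis n_gt0 : (0 < n)%N.
Hypothesis h01 : 0 <= h <= 2^-1.
Hypothesis theta01 : 0 <= theta <= 1.

Lemma total_peak_ge0 A : 0 <= total_peak A.
Proof. by apply: sumr_ge0 => x _; exact: peak_ge0. Qed.

Lemma total_energy_ge0 A : 0 <= total_energy A.
Proof. by apply: sumr_ge0 => x _; exact: energy_ge0. Qed.

Definition moved_energy A M : R :=
  \sum_x \sum_(l < n | is_front (word A x) l)
    weight n h theta (word A x) l * front_factor h theta (word M x l.+1).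

Section Movement.
Variables (A M : config n).
Hypothesis density_A : #|A|%:R <= h * n%:R.
Hypotheses (MA : M \subset A) (prob_neq0 : move_prob p A M != 0).

Let density x : excess h (word A x) n <= 0.
Proof. by rewrite excess_word subr_le0. Qed.

Let free x l : word M x l -> word A x l && ~~ word A x l.+1.
Proof.
move=> Ml; rewrite /word (fintype.subsetP MA _ Ml) /=.
exact: (support_free MA prob_neq0 Ml).
Qed.

Let isolated x l :
  word A x l.+1 -> ~~ word A x l -> ~~ word A x l.+2 -> word M x l.+1.
Proof.
move=> a1 a0 a2; apply: (support_isolated prob_neq0) => //.
by rewrite iterS ordSK.
Qed.

Lemma total_peak_moved :
  total_peak (moved A M) <= total_peak A + total_energy A - #|blocked A|%:R.
Proof.
rewrite /total_peak (reindex_inj (@ordS_inj n)) /=.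
have -> : #|blocked A|%:R = \sum_x (word A x 0 && word A x 1)%:R :> R.
  rewrite -natr_sum -sum1_card big_mkcond /=; congr (_%:R).
  by apply: eq_bigr => x _; rewrite inE /word /=; case: ifP.
rewrite -big_split /= -sumrB; apply: ler_sum => x _.
apply: (@peak_step R n h theta (word A x) (word M x)) => //.
- by move=> l; exact: word_addn.
- exact: free.
- exact: isolated.
- by move=> l; exact: word_moved.
Qed.

Lemma total_energy_moved : total_energy (moved A M) <= moved_energy A M.
Proof.
rewrite /total_energy (reindex_inj (@ordS_inj n)) /=; apply: ler_sum => x _.
apply: (@energy_step R n h theta (word A x) (word M x)) => //.
- by move=> l; exact: word_addn.
- by move=> l; exact: word_addn.
- exact: free.
- exact: isolated.
- by move=> l; exact: word_moved.
Qed.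

End Movement.

Lemma mean_moved_energy A :
  \sum_(M : config n | M \subset A) move_prob p A M * moved_energy A M =
  decay * total_energy A.
Proof.
rewrite /total_energy /energy mulr_sumr.
under eq_bigr do rewrite /moved_energy mulr_sumr.
rewrite exchange_big /=; apply: eq_bigr => x _.
under eq_bigr do rewrite mulr_sumr.
rewrite exchange_big mulr_sumr /=; apply: eq_bigr => l /and3P[a0 a1 a2].
under eq_bigr do rewrite mulrCA.
rewrite -mulr_sumr mulrC; congr (_ * _).
rewrite (move_prob_marginal p (front_factor h theta) a1) /decay /jump_prob.
by rewrite [_ \in A](negbTE a2) iterS ordSK [_ \in A]a0.
Qed.

Lemma word_relocate A i j x l :
  ~~ ((iter l (@ordS n) x == i) || (iter l (@ordS n) x == j)) ->
  word (relocate A i j) x l = word A x l.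
Proof. by rewrite negb_or /word !inE => /andP[-> /negbTE ->]. Qed.

Lemma total_peak_relocate A i j :
  total_peak (relocate A i j) <= total_peak A + 3 * n%:R.
Proof.
have -> : 3 * n%:R = \sum_(x < n) 3 :> R by rewrite sumr_const card_ord mulr_natr.
rewrite -big_split /=; apply: ler_sum => x _; rewrite -lerBlDl.
apply: le_trans (ler_norm _) _.
apply: (@peak_perturb R n h (word A x) _ (fun l =>
  (iter l (@ordS n) x == i) || (iter l (@ordS n) x == j))) => //.
- by move=> l; exact: word_relocate.
- by move=> k; exact: sum_hits.
Qed.

Lemma total_energy_relocate A i j :
  total_energy (relocate A i j) <=
  expR (6 * theta) * total_energy A + 6 * expR theta * n%:R.
Proof.
have -> : 6 * expR theta * n%:R = \sum_(x < n) 6 * expR theta :> R.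
  by rewrite sumr_const card_ord mulr_natr.
rewrite mulr_sumr -big_split /=; apply: ler_sum => x _.
apply: (@energy_perturb R n h theta (word A x) _ (fun l =>
  (iter l (@ordS n) x == i) || (iter l (@ordS n) x == j))) => //.
- by move=> l; exact: word_relocate.
- by move=> k; exact: sum_hits.
Qed.

(** The peak gains at most [total_energy A], which the decay of the energy, multiplied by [B], pays
    for: this is the last hypothesis. A perturbation has probability lambda / n and cost O(n), which
    leaves the constant. *)
Lemma lyapunov_drift (lambda B : R) A :
  0 <= p <= 1 -> 0 <= lambda <= n%:R -> 0 <= B -> #|A|%:R <= h * n%:R ->
  1 + B * (1 + lambda / n%:R * expR (6 * theta)) * decay <= B ->
  step_mean p lambda A (fun M o => lyapunov B (Defs.next A M o)) <=
  lyapunov B A - #|blocked A|%:R + lambda * (3 + 6 * B * expR theta).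
Proof.
move=> p01 /andP[lambda0 lambdan] B0 density_A decayB.
have nR : 0 < n%:R :> R by rewrite ltr0n.
set q := lambda / n%:R; rewrite -/q in decayB.
have q0 : 0 <= q by rewrite divr_ge0.
have q1 : q <= 1 by rewrite ler_pdivrMr // mul1r.
set C := 3 + 6 * B * expR theta; set e6 := expR (6 * theta) in decayB *.
have e60 : 0 <= e6 by exact: expR_ge0.
have C0 : 0 <= C by rewrite addr_ge0 // !mulr_ge0 ?expR_ge0.
pose bound M := total_peak A + total_energy A - #|blocked A|%:R
  + B * (1 + q * e6) * moved_energy A M + lambda * C.
apply: (@le_trans _ _ (\sum_(M : config n | M \subset A) move_prob p A M * bound M)).
  apply: ler_sum => M MA.
  have [->|M0] := eqVneq (move_prob p A M) 0; first by rewrite !mul0r.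
  rewrite ler_wpM2l ?move_prob_ge0 //= -/q.
  have peakM := total_peak_moved density_A MA M0.
  have energyM := total_energy_moved density_A MA M0.
  have E0 := total_energy_ge0 (moved A M); have P0 := total_peak_ge0 (moved A M).
  set pert := perturb_mean _ _.
  have pm : pert <= lyapunov B (moved A M) + B * e6 * total_energy (moved A M) + C * n%:R.
    apply: perturb_mean_le => [|i j].
      by rewrite !addr_ge0 // !mulr_ge0.
    rewrite /lyapunov.
    have := total_peak_relocate (moved A M) i j.
    have := ler_wpM2l B0 (total_energy_relocate (moved A M) i j).
    have : 0 <= B * total_energy (moved A M) by rewrite mulr_ge0.
    rewrite -/e6 /C; lra.
  have qn : q * n%:R = lambda by rewrite divfK ?gt_eqF.
  have := ler_wpM2l q0 pm.
  have : q * (C * n%:R) = lambda * C by rewrite mulrCA qn mulrC.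
  have : B * (1 + q * e6) * total_energy (moved A M) <= B * (1 + q * e6) * moved_energy A M.
    by rewrite ler_wpM2l // mulr_ge0 // addr_ge0 // mulr_ge0.
  rewrite /bound /lyapunov; lra.
under eq_bigr do rewrite /bound mulrDr mulrDr mulrCA.
rewrite !big_split /= -!mulr_suml -mulr_sumr mean_moved_energy !sum_move_prob !mul1r.
have := ler_wpM2r (total_energy_ge0 A) decayB.
rewrite /lyapunov; lra.
Qed.

End Drift.

(** * Clusters are counted by blocked particles *)

Section Clusters.
Context {n : nat}.
Implicit Types (A C D : config n) (i j : 'I_n).

Lemma iter_cwdist i j : iter (cwdist i j) (@ordS n) i = j.
Proof.
apply: val_inj; rewrite /= val_iter_ordS /cwdist modnDmr.
by rewrite subnKC ?modnDr ?modn_small // ltnW // ltn_addl.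
Qed.

Lemma cwdist_lt i j : (cwdist i j < n)%N.
Proof. by rewrite ltn_mod; apply: leq_ltn_trans (ltn_ord i). Qed.

Lemma cwdist_iter_le i l : (cwdist i (iter l (@ordS n) i) <= l)%N.
Proof.
have [ln|] := ltnP l n; last by apply: leq_trans; exact: ltnW (cwdist_lt _ _).
have /(_ (Ordinal (cwdist_lt i (iter l (@ordS n) i))) (Ordinal ln)) := @iter_ordS_inj n i.
by move=> /= /(_ (iter_cwdist _ _)) [->].
Qed.

Lemma contiguousP C : contiguous C ->
  exists i, forall j, (j \in C) = (cwdist i j < #|C|)%N.
Proof. by case/existsP => i /eqP CE; exists i => j; rewrite {1}CE inE. Qed.

Lemma contiguous_from C i :
  (forall j, (j \in C) = (cwdist i j < #|C|)%N) -> contiguous C.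
Proof. by move=> CE; apply/existsP; exists i; apply/eqP/setP => j; rewrite inE CE. Qed.

(** Every site of an arc except possibly the last has its right neighbour in the arc. *)
Lemma card_contiguous C : contiguous C -> (#|C|.-1 <= #|blocked C|)%N.
Proof.
case/contiguousP => i CE; rewrite -subn1 leq_subLR -(cardsID (blocked C)) addnC.
rewrite leq_add // ?subset_leq_card ?subsetIr //.
rewrite -(cards1 (iter #|C|.-1 (@ordS n) i)); apply/subset_leq_card/fintype.subsetP => j.
rewrite !inE negb_and => /andP[+ jC]; rewrite jC /= => SjC.
have jl := iter_cwdist i j; move: jC; rewrite CE => jC.
suff -> : #|C|.-1 = cwdist i j by rewrite jl.
apply/eqP; rewrite eqn_leq -[X in _ && X]ltnS (ltn_predK jC) jC andbT leqNgt.
apply: contraNN SjC => ltC; rewrite CE -{1}jl -iterS.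
by apply: leq_ltn_trans (cwdist_iter_le _ _) _; rewrite -ltn_predRL.
Qed.

Section Maximal.
Variables (A C : config n).
Hypothesis C_max : maxset (fun D => contiguous D && (D \subset A)) C.

Let CA : C \subset A. Proof. by case/andP: (maxsetp C_max). Qed.
Let Cc : contiguous C. Proof. by case/andP: (maxsetp C_max). Qed.

(** Adjoining [z] would give a longer arc inside [A], against maximality. *)
Lemma maxset_extend z i :
  z \in A -> z \notin C ->
  (forall j, (cwdist i j < #|C|.+1)%N = (j == z) || (j \in C)) -> False.
Proof.
move=> zA zC extC; have DE : contiguous (z |: C).
  by apply: (@contiguous_from _ i) => j; rewrite cardsU1 zC add1n extC !inE.
have := maxsetsup C_max; move=> /(_ (z |: C)); rewrite DE /=.
rewrite finset.subUset CA finset.sub1set zA => /(_ isT (subsetU1 _ _)) CE.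
by move: zC; rewrite -CE setU11.
Qed.

Lemma maxset_ordS z : z \in C -> ordS z \in A -> ordS z \in C.
Proof.
move=> zC SzA; apply: contraT => SzC; exfalso.
have [i CE] := contiguousP Cc.
have zl := iter_cwdist i z; move: (zC); rewrite CE leq_eqVlt => /orP[/eqP cz|cz]; last first.
  move: SzC; rewrite CE -{1}zl -iterS; move/negP; apply.
  by apply: leq_ltn_trans cz; exact: cwdist_iter_le.
apply: (maxset_extend (i := i) SzA SzC) => j.
rewrite ltnS leq_eqVlt -CE; congr (_ || _); apply/eqP/eqP => [jC|->].
  by rewrite -(iter_cwdist i j) jC -cz iterS zl.
apply/eqP; rewrite eqn_leq andbC leqNgt -CE SzC -{1}zl -iterS -cz.
exact: cwdist_iter_le.
Qed.

Lemma maxset_ord_pred z : z \in C -> ord_pred z \in A -> ord_pred z \in C.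
Proof.
move=> zC PzA; apply: contraT => PzC; exfalso.
have [i CE] := contiguousP Cc.
have zl := iter_cwdist i z.
(* Unless [z] is the first site of the arc, its predecessor lies in the arc; if it is the first, the
   arc extends leftwards. *)
case dz : (cwdist i z) => [|l]; last first.
  move: PzC; rewrite CE -zl dz iterS ordSK; move/negP; apply.
  move: zC; rewrite CE dz; apply: leq_ltn_trans.
  by apply: leq_trans (cwdist_iter_le _ _) _.
move: zl; rewrite dz /= => iz; subst i.
apply: (maxset_extend (i := ord_pred z) PzA PzC) => j.
rewrite CE; apply/idP/orP => [|[/eqP ->|jC]].
- have jl := iter_cwdist (ord_pred z) j; case: (cwdist _ j) jl => [<- _|l]; first by left.
  rewrite iterSr ord_predK => <- lC; right.
  by apply: leq_ltn_trans (cwdist_iter_le _ _) _.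
- by apply: leq_ltn_trans (cwdist_iter_le _ 0) _.
- have jl : j = iter (cwdist z j).+1 (@ordS n) (ord_pred z).
    by rewrite iterSr ord_predK iter_cwdist.
  by rewrite jl; apply: leq_ltn_trans (cwdist_iter_le _ _) _.
Qed.

End Maximal.

(** Walking along [D] from the common site in both directions never leaves [C], so [D] lies in [C]
    and the maximality of [D] gives equality. *)
Lemma maxset_contiguous_inj A C D j :
  maxset (fun D => contiguous D && (D \subset A)) C ->
  maxset (fun D => contiguous D && (D \subset A)) D ->
  j \in C -> j \in D -> C = D.
Proof.
move=> Cmax Dmax jC jD.
have /andP[Dc DA] := maxsetp Dmax; have Cp := maxsetp Cmax.
apply: (maxsetsup Dmax) => //; apply/fintype.subsetP => k kD.
have [i DE] := contiguousP Dc.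
have inA l : (l < #|D|)%N -> iter l (@ordS n) i \in A.
  move=> lD; apply: (fintype.subsetP DA); rewrite DE.
  by apply: leq_ltn_trans (cwdist_iter_le _ _) _.
have up l d : (l + d < #|D|)%N -> iter l (@ordS n) i \in C ->
    iter (l + d) (@ordS n) i \in C.
  elim: d => [|d IH]; first by rewrite addn0.
  rewrite addnS => ld lC; rewrite iterS; apply: (maxset_ordS Cmax).
    by apply: IH => //; exact: ltnW.
  by rewrite -iterS; exact: inA.
have down d l : (l + d < #|D|)%N -> iter (l + d) (@ordS n) i \in C ->
    iter l (@ordS n) i \in C.
  elim: d l => [|d IH] l; first by rewrite addn0.
  rewrite -addSnnS => ld lC; have SlC := IH _ ld lC.
  rewrite -[iter l _ _]ordSK -iterS; apply: (maxset_ord_pred Cmax) => //.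
  by rewrite iterS ordSK; apply: inA; apply: leq_ltn_trans ld; rewrite addSn -addnS leq_addr.
move: jC (jD) (kD); rewrite !DE -{1}(iter_cwdist i j) -{2}(iter_cwdist i k).
set t := cwdist i j; set s := cwdist i k => tC tD sD.
have [ts|/ltnW st] := leqP t s.
  by move: (up t (s - t)%N); rewrite subnKC //; apply.
by move: (down (t - s)%N s); rewrite subnKC //; apply.
Qed.

(** Double counting: clusters are disjoint, so each blocked particle is counted at most once. *)
Lemma sum_card_clusters A :
  (\sum_(C in clusters A) #|C|.-1 <= #|blocked A|)%N.
Proof.
apply: (@leq_trans (\sum_(C in clusters A) #|blocked C|)).
  apply: leq_sum => C; rewrite inE => /andP[/maxsetp /andP[Cc _] _].
  exact: card_contiguous.
have -> : (\sum_(C in clusters A) #|blocked C| =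
    \sum_(j in blocked A) \sum_(C in clusters A) (j \in blocked C))%N.
  rewrite exchange_big; apply: eq_bigr => C.
  rewrite inE => /andP[/maxsetp /andP[_ /fintype.subsetP CA] _].
  rewrite -sum1_card big_mkcond [RHS]big_mkcond; apply: eq_bigr => j _.
  rewrite !inE; case: (boolP (j \in C)) => jC /=; last by case: ifP.
  by rewrite CA //=; case: (boolP (ordS j \in C)) => [/CA ->|]//; case: ifP.
rewrite -sum1_card; apply: leq_sum => j _.
case: (pickP [pred C in clusters A | j \in blocked C]) => /= [D /andP[DA jD]|none].
  rewrite (bigD1 D DA) /= jD big1 // => C /andP[CA CD].
  case: (boolP (j \in blocked C)) => // jC; move/eqP: CD; case.
  have {}CA : C \in clusters A := CA.
  move: CA DA jC jD; rewrite !inE.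
  move=> /andP[Cmax _] /andP[Dmax _] /andP[jC _] /andP[jD _].
  exact: maxset_contiguous_inj Cmax Dmax jC jD.
by rewrite big1 // => C CA; have := none C; rewrite /= CA /= => ->.
Qed.

Lemma card_clusters A : (#|clusters A| <= #|blocked A|)%N.
Proof.
apply: leq_trans (sum_card_clusters A); rewrite -sum1_card; apply: leq_sum => C.
by rewrite inE => /andP[_]; case: #|C| => [//|[]].
Qed.

Lemma scaled_tau_ge0 (R : realType) A : 0 <= scaled_tau A :> R.
Proof. by apply: sumr_ge0 => C _; rewrite divr_ge0. Qed.

Lemma scaled_tau_le (R : realType) A : scaled_tau A <= #|blocked A|%:R / n%:R :> R.
Proof.
rewrite /scaled_tau -mulr_suml ler_wpM2r ?invr_ge0 // -natr_sum ler_nat.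
exact: sum_card_clusters.
Qed.

End Clusters.

(** * Second-order bound on the decay factor *)

Lemma expR_le_quadratic (R : realType) (y : R) :
  y <= 2^-1 -> expR y <= 1 + y + 2 * y ^+ 2.
Proof.
(* Here exp y (1 - y) <= 1, while (1 + y + 2y^2)(1 - y) = 1 + y^2 (1 - 2y) >= 1. *)
move=> y2; have := expR_ge1Dx (- y); have := expR_gt0 y.
have := expRxMexpNx_1 y; set e := expR y; set e' := expR (- y) => ee e0 le_e'.
have: e * (1 - y) <= 1 by rewrite -[leRHS]ee ler_wpM2l // ltW.
have : 1 <= (1 + y + 2 * y ^+ 2) * (1 - y).
  have -> : (1 + y + 2 * y ^+ 2) * (1 - y) = 1 + y ^+ 2 * (1 - 2 * y) by ring.
  by rewrite lerDl mulr_ge0 ?sqr_ge0; lra.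
move=> le1 /le_trans /(_ le1); rewrite ler_pM2r //; lra.
Qed.

(** The first-order term is theta times the drift p (2h - 1) + (1 - p) h = h (1 + p) - p. *)
Lemma decay_le (R : realType) (p h theta : R) :
  0 <= p <= 1 -> 0 <= h <= 2^-1 -> 0 <= theta <= 1 ->
  decay p h theta <= 1 - theta * (p - h * (1 + p)) + 2 * theta ^+ 2.
Proof.
move=> /andP[p0 p1] /andP[h0 h1] /andP[t0 t1]; rewrite /decay /front_factor.
have th0 : 0 <= theta * h by rewrite mulr_ge0.
have th1 : theta * h <= 2^-1.
  by rewrite -[leRHS]mul1r ler_pM.
have tk0 : 0 <= theta * (1 - 2 * h) by rewrite mulr_ge0; lra.
have := @expR_le_quadratic _ (theta * h) th1.
have : - theta * (1 - 2 * h) <= 2^-1 by rewrite mulNr; lra.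
move=> /expR_le_quadratic.
set e1 := expR _; set e2 := expR _ => le1 le2.
have le1' : p * e1 <= p * (1 - theta * (1 - 2 * h) + 2 * theta ^+ 2).
  rewrite ler_wpM2l //; apply: le_trans le1 _; rewrite mulNr sqrrN lerD2l.
  rewrite exprMn ler_wpM2l // -[leRHS]mulr1 ler_wpM2l ?sqr_ge0 //.
  by rewrite expr_le1 //; lra.
have le2' : (1 - p) * e2 <= (1 - p) * (1 + theta * h + 2 * theta ^+ 2).
  rewrite ler_wpM2l ?subr_ge0 //; apply: le_trans le2 _; rewrite lerD2l.
  rewrite exprMn ler_wpM2l // -[leRHS]mulr1 ler_wpM2l ?sqr_ge0 //.
  by rewrite expr_le1 //; lra.
apply: le_trans (lerD le1' le2') _; rewrite le_eqVlt; apply/orP; left; apply/eqP; ring.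
Qed.

(** * Stationary means and the flux for fixed n *)

Section Stationary.
Context {R : realType} {n : nat}.
Variables (p lambda : R).
Implicit Types (A M : config n).

(** Invariance concerns point masses; writing [f] as a combination of point indicators transfers it
    to [f]. *)
Lemma mean_step (k : nat) (nu : config n -> R) (f : config n -> R) :
  stationary p lambda k nu ->
  mean nu (fun A => step_mean p lambda A (fun M o => f (Defs.next A M o))) = mean nu f.
Proof.
case=> _ _ _ inv; rewrite /mean.
under [RHS]eq_bigr => B _ do rewrite inv mulr_suml.
rewrite exchange_big /=; apply: eq_bigr => A _.
under eq_bigr => B _ do rewrite -mulrA.
rewrite -mulr_sumr; congr (_ * _).
have pick (B0 : config n) : f B0 = \sum_B (B0 == B)%:R * f B.
  rewrite (bigD1 B0) //= eqxx mul1r big1 ?addr0 // => B /negbTE.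
  by rewrite eq_sym => ->; rewrite mul0r.
rewrite /transition /step_mean.
under [RHS]eq_bigr => B _ do rewrite mulr_suml.
rewrite exchange_big /=; apply: eq_bigr => M _.
under [RHS]eq_bigr => B _ do rewrite -mulrA.
rewrite -mulr_sumr; congr (_ * _).
under [RHS]eq_bigr => B _ do rewrite mulrDl -[X in X + _]mulrA -[X in _ + X]mulrA.
rewrite big_split /= -!mulr_sumr; congr (_ * _ + _ * _); first exact: pick.
rewrite /perturb_mean.
under [RHS]eq_bigr => B _ do rewrite mulr_suml.
rewrite exchange_big /=; apply: eq_bigr => i _.
under [RHS]eq_bigr => B _ do rewrite mulr_suml.
rewrite exchange_big /=; apply: eq_bigr => j _.
under [RHS]eq_bigr => B _ do rewrite mulrAC.
by rewrite -mulr_suml -pick.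
Qed.

Lemma mean_le (k : nat) (nu f g : config n -> R) :
  stationary p lambda k nu -> (forall A, #|A| = k -> f A <= g A) ->
  mean nu f <= mean nu g.
Proof.
case=> nu0 nuk _ _ fg; apply: ler_sum => A _.
have [Ak|Ak] := eqVneq #|A| k; first by rewrite ler_wpM2l // fg.
by rewrite nuk // !mul0r.
Qed.

Lemma meanD (nu f g : config n -> R) :
  mean nu (fun A => f A + g A) = mean nu f + mean nu g.
Proof. by rewrite /mean -big_split; apply: eq_bigr => A _; rewrite mulrDr. Qed.

Lemma meanZ (nu f : config n -> R) (c : R) :
  mean nu (fun A => c * f A) = c * mean nu f.
Proof. by rewrite /mean mulr_sumr; apply: eq_bigr => A _; rewrite mulrCA. Qed.

Lemma mean_cst (k : nat) (nu : config n -> R) (c : R) :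
  stationary p lambda k nu -> mean nu (fun=> c) = c.
Proof. by case=> _ _ nu1 _; rewrite /mean -mulr_suml nu1 mul1r. Qed.

Section Travel.
Variable A : config n.
Hypotheses (p01 : 0 <= p <= 1) (n_gt0 : (0 < n)%N) (lambda_n : 0 <= lambda <= n%:R).

Let q0 : 0 <= lambda / n%:R.
Proof. by case/andP: lambda_n => *; rewrite divr_ge0. Qed.

Let q1 : 0 <= 1 - lambda / n%:R.
Proof. by case/andP: lambda_n => *; rewrite subr_ge0 ler_pdivrMr ?ltr0n // mul1r. Qed.

Lemma psi_le : psi p lambda A <= #|A|%:R + lambda.
Proof.
rewrite /psi /step_mean -[leRHS]mul1r -[X in _ <= X * _](sum_move_prob p A) mulr_suml.
apply: ler_sum => M MA; rewrite ler_wpM2l ?move_prob_ge0 //=.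
set m : R := (travelled M None)%:R; set pm := perturb_mean _ _.
have mA : m <= #|A|%:R by rewrite /m ler_nat /travelled addn0 subset_leq_card.
have pmM : pm <= m + n%:R.
  apply: perturb_mean_le => [|i j]; first by rewrite addr_ge0.
  by rewrite /= /m -natrD ler_nat /travelled addn0 leq_add2l ltnW // cwdist_lt.
have := ler_wpM2l q0 pmM; have -> : lambda / n%:R * (m + n%:R) = lambda / n%:R * m + lambda.
  by rewrite mulrDr divfK // pnatr_eq0 -lt0n.
lra.
Qed.

(** A particle that does not move is blocked or has a blocked left neighbour, since isolated
    particles move. *)
Lemma card_support M : M \subset A -> move_prob p A M != 0 ->
  (#|A| <= #|M| + 2 * #|blocked A|)%N.
Proof.
move=> MA M0.
have AE : A \subset M :|: (blocked A :|: [set ordS i | i in blocked A]).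
  apply/fintype.subsetP => i iA; rewrite !inE iA /=.
  have [//|iM] := boolP (i \in M); have [//|SiA /=] := boolP (ordS i \in A).
  rewrite -(ord_predK i) mem_imset ?inE ?ord_predK ?iA ?andbT; last exact: ordS_inj.
  by apply: contraNT iM => PiA; exact: support_isolated M0 _ iA SiA PiA.
apply: leq_trans (subset_leq_card AE) _; apply: leq_trans (leq_card_setU _ _) _.
rewrite leq_add2l mul2n -addnn; apply: leq_trans (leq_card_setU _ _) _.
by rewrite leq_add2l leq_imset_card.
Qed.

Lemma psi_ge : #|A|%:R - 2 * #|blocked A|%:R - lambda <= psi p lambda A.
Proof.
rewrite /psi /step_mean -[leLHS]mul1r -[X in X * _ <= _](sum_move_prob p A) mulr_suml.
apply: ler_sum => M MA; have [->|M0] := eqVneq (move_prob p A M) 0; first by rewrite !mul0r.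
rewrite ler_wpM2l ?move_prob_ge0 //=.
set m : R := (travelled M None)%:R; set pm := perturb_mean _ _.
(* Bounding the travel in perturbed steps below by 0 costs at most lambda, since at most [n]
   particles move. *)
have pm0 : 0 <= pm by exact: perturb_mean_ge0.
have : #|A|%:R <= m + 2 * #|blocked A|%:R.
  by rewrite /m /travelled addn0 -natrM -natrD ler_nat card_support.
have mn : m <= n%:R.
  by rewrite /m /travelled addn0 ler_nat -[leqRHS]card_ord max_card.
have qn : lambda / n%:R * n%:R = lambda by rewrite divfK // pnatr_eq0 -lt0n.
have : lambda / n%:R * m <= lambda by rewrite -[leRHS]qn ler_wpM2l.
have := mulr_ge0 q0 pm0; lra.
Qed.

End Travel.

Lemma flux_bounds (k : nat) (nu : config n -> R) :
  0 <= p <= 1 -> (0 < n)%N -> 0 <= lambda <= n%:R -> stationary p lambda k nu ->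
  (k%:R - lambda - 2 * mean nu (fun A => #|blocked A|%:R)) / n%:R
    <= flux p lambda nu <= (k%:R + lambda) / n%:R.
Proof.
move=> p01 n0 lambdan nuS.
have -> : flux p lambda nu = mean nu (psi p lambda) / n%:R.
  by rewrite /flux /mean mulr_suml; apply: eq_bigr => A _; rewrite mulrA.
have nR : 0 < (n%:R : R) by rewrite ltr0n.
rewrite !ler_pM2r ?invr_gt0 //; apply/andP; split; last first.
  rewrite -(mean_cst (k%:R + lambda) nuS); apply: mean_le nuS _ => A <-.
  exact: psi_le.
rewrite -(mean_cst (k%:R - lambda) nuS) -mulNr -meanZ -meanD.
by apply: mean_le nuS _ => A <-; have := psi_ge A p01 n0 lambdan; lra.
Qed.

End Stationary.

(** * Uniform bound on the mean number of blocked particles *)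

Section Asymptotics.
Context {R : realType}.
Variables (p lambda rho : R) (nu : forall n : nat, config n -> R).
Arguments nu : clear implicits.
Hypotheses (hp : 0 < p <= 1) (hlambda : 0 < lambda) (hrho : 0 < rho < p / (1 + p)).
Hypothesis hnu : forall n : nat, lambda <= n%:R ->
  stationary p lambda (num_particles rho n) (nu n).

Lemma num_particles_bounds n :
  rho * n%:R <= (num_particles rho n)%:R <= rho * n%:R + 1.
Proof.
have rn0 : 0 <= rho * n%:R by rewrite mulr_ge0 // ltW //; case/andP: hrho.
rewrite /num_particles natr_absz ger0_norm ?ceil_ge0; last by lra.
have /andP[+ ->] := ceil_itv (rho * n%:R); rewrite intrB.
by lra.
Qed.

(** In the stationary mean the two Lyapunov terms of the drift inequality cancel, leaving its
    constant as [K]. *)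
Lemma mean_blocked_bounded : exists2 K, 0 <= K &
  \forall n \near \oo, [/\ (0 < n)%N, lambda <= n%:R,
    stationary p lambda (num_particles rho n) (nu n) &
    mean (nu n) (fun A => #|blocked A|%:R) <= K].
Proof.
have /andP[p0 p1] := hp; have /andP[rho0 rhoh] := hrho.
(* Being above rho, h exceeds the actual density for large n; being below p / (1 + p), it gives the
   negative drift -d. *)
pose h := (rho + p / (1 + p)) / 2; pose d := p - h * (1 + p).
have hp1 : 0 < 1 + p by lra.
have hE : p / (1 + p) * (1 + p) = p by rewrite divfK ?gt_eqF.
have hh : h < p / (1 + p) by rewrite /h; lra.
have rh : rho < h by rewrite /h; lra.
have p2 : p / (1 + p) <= 2^-1 by rewrite ler_pdivrMr //; lra.
have d0 : 0 < d by rewrite subr_gt0 -[ltRHS]hE ltr_pM2r.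
have d1 : d <= 1.
  by have : 0 <= h * (1 + p) by [rewrite mulr_ge0; lra]; rewrite /d; lra.
(* This theta minimises -theta d + 2 theta^2, and the minimum is -c. *)
pose theta := d / 4; pose c := d ^+ 2 / 8.
have c0 : 0 < c by rewrite divr_gt0 ?exprn_gt0.
have c1 : c <= 1.
  have : d ^+ 2 <= 1 by rewrite expr_le1 // ltW.
  by rewrite /c; lra.
(* One half of the decay c pays for the gain of the peak, as B c / 2 = 1; the other half absorbs the
   perturbations. *)
pose B := 2 / c; pose e6 := expR (6 * theta).
have B0 : 0 <= B by rewrite divr_ge0 // ltW.
have h01 : 0 <= h <= 2^-1 by apply/andP; split; lra.
have theta01 : 0 <= theta <= 1 by rewrite /theta; apply/andP; split; lra.
have p01 : 0 <= p <= 1 by rewrite p1 ltW.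
have decay_c : decay p h theta <= 1 - c.
  apply: le_trans (decay_le p01 h01 theta01) _.
  by rewrite -/d /theta /c le_eqVlt; apply/orP; left; apply/eqP; field.
have e60 : 0 <= e6 by exact: expR_ge0.
exists (lambda * (3 + 6 * B * expR theta)).
  apply: mulr_ge0; first exact: ltW.
  by apply: addr_ge0 => //; apply: mulr_ge0 (expR_ge0 _); exact: mulr_ge0.
near=> n.
have n0 : (0 < n)%N by near: n; exact: nbhs_infty_gt.
have nR : 0 < n%:R :> R by rewrite ltr0n.
have ln : lambda <= n%:R by near: n; exact: nbhs_infty_ger.
have stat := hnu ln; split => //.
have kh : (num_particles rho n)%:R <= h * n%:R.
  have /andP[_ kle] := num_particles_bounds n; apply: le_trans kle _.
  have hr0 : 0 < h - rho by rewrite subr_gt0.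
  have hr : (h - rho)^-1 <= n%:R by near: n; exact: nbhs_infty_ger.
  by have := ler_wpM2l (ltW hr0) hr; rewrite mulfV ?gt_eqF //; lra.
have small : lambda / n%:R * e6 <= c / 2.
  have : 2 * lambda * e6 / c <= n%:R by near: n; exact: nbhs_infty_ger.
  by rewrite ler_pdivrMr // => le_nc; rewrite mulrAC ler_pdivrMr //; lra.
have decayB : 1 + B * (1 + lambda / n%:R * e6) * decay p h theta <= B.
  have q0 : 0 <= lambda / n%:R * e6 by rewrite mulr_ge0 // divr_ge0 // ltW.
  have : (1 + lambda / n%:R * e6) * decay p h theta <= 1 - c / 2.
    apply: (@le_trans _ _ ((1 + lambda / n%:R * e6) * (1 - c))).
      by rewrite ler_wpM2l // addr_ge0.
    apply: (@le_trans _ _ ((1 + c / 2) * (1 - c))); last by nra.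
    by rewrite ler_wpM2r ?subr_ge0 // lerD2l.
  move=> /(ler_wpM2l B0); rewrite mulrA.
  have : B * (c / 2) = 1 by rewrite /B; field; rewrite gt_eqF.
  by lra.
have := mean_step (lyapunov h theta B) stat.
have drift (A : config n) : #|A| = num_particles rho n ->
    step_mean p lambda A (fun M o => lyapunov h theta B (Defs.next A M o)) +
      #|blocked A|%:R <=
    lyapunov h theta B A + lambda * (3 + 6 * B * expR theta).
  move=> Ak; have := @lyapunov_drift R n p h theta n0 h01 theta01 lambda B A p01.
  rewrite Ak ln (ltW hlambda) => /(_ isT B0 kh decayB); lra.
have := mean_le stat drift; rewrite !meanD (mean_cst _ stat); lra.
Unshelve. all: by end_near.
Qed.

End Asymptotics.

(** * Subsequences, Borel measurability and test functions *)

Lemma near_subseq (s : nat -> nat) (P : nat -> Prop) :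
  {homo s : i j / (i < j)%N} -> (\forall n \near \oo, P n) ->
  \forall m \near \oo, P (s m).
Proof.
move=> hs [N _ PN]; exists N => // m /= Nm; apply: PN => /=.
have le_s k : (k <= s k)%N.
  by elim: k => // k IH; apply: leq_ltn_trans IH _; exact: hs.
exact: leq_trans Nm (le_s m).
Qed.

Lemma borel_measurable_continuous (R : realType) (X : ptopologicalType)
    (f : X -> R) :
  continuous f -> measurable_fun (setT : set (borelType X)) f.
Proof.
move=> /continuousP cf; apply: (measurability _ (RGenOpens.measurableE R)).
move=> _ [_ [a [b ->] <-]]; rewrite setTI; apply: sub_sigma_algebra.
exact/cf/interval_open.
Qed.

Lemma borel_measurable_EFin (R : realType) (X : ptopologicalType) (f : X -> R) :
  continuous f -> measurable_fun (setT : set (borelType X)) (fun x => (f x)%:E).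
Proof.
by move=> /borel_measurable_continuous /measurable_EFinP.
Qed.

(** The balls of the extended line are pulled back along [contract]. *)
Lemma contract_continuous (R : realType) : continuous (@contract R).
Proof.
move=> x; apply/cvgrPdist_lt => e e0.
by apply: filterS (nbhsx_ballx x e e0) => y.
Qed.

Section TestFunctions.
Context {R : realType} {X : ptopologicalType}.
Variables (mu : probability (borelType X) R).

Lemma integral_test (f : X -> R) : continuous f -> (forall x, 0 <= f x <= 1) ->
  (\int[mu]_x (f x)%:E = (\int[mu]_x f x)%:E)%E.
Proof.
move=> cf f01; rewrite /Rintegral fineK // ge0_fin_numE.
  apply: le_lt_trans (ltry 1); rewrite -(probability_setT mu) -[leRHS]mul1e.
  rewrite -(integral_cst mu measurableT); apply: ge0_le_integral => //.
  - by move=> x _; rewrite lee_fin; case/andP: (f01 x).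
  - exact: borel_measurable_EFin.
  - by move=> x _; rewrite lee_fin; case/andP: (f01 x).
by apply: integral_ge0 => x _; rewrite lee_fin; case/andP: (f01 x).
Qed.

(** The indicator of [S] lies below each test function, so the measure of [S] is at most every e >
    0. *)
Lemma negligible_test (S : set X) :
  measurable (S : set (borelType X)) ->
  (forall e, 0 < e -> exists f : X -> R, [/\ continuous f,
     forall x, 0 <= f x <= 1, forall x, S x -> f x = 1 & \int[mu]_x f x <= e]) ->
  mu.-negligible S.
Proof.
move=> mS test; exists S; split => //.
apply/eqP; rewrite eq_le measure_ge0 andbT; apply/lee_addgt0Pr => e e0; rewrite add0e.
have [f [cf f01 fS fe]] := test e e0.
apply: (@le_trans _ _ (\int[mu]_x (f x)%:E)%E); last by rewrite integral_test // lee_fin.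
rewrite -[S in leLHS]setIT -integral_indic //; apply: ge0_le_integral => //.
- exact/measurable_EFinP/measurable_indic.
- exact: borel_measurable_EFin.
- move=> x _; rewrite lee_fin indicE; case: (boolP (x \in S)) => [|_].
    by rewrite inE => /fS ->.
  by case/andP: (f01 x).
Qed.

End TestFunctions.

(** * Passage to the limit *)

Section Limits.
Context {R : realType}.
Variables (p lambda rho : R) (nu : forall n : nat, config n -> R).
Arguments nu : clear implicits.
Hypotheses (hp : 0 < p <= 1) (hlambda : 0 < lambda) (hrho : 0 < rho < p / (1 + p)).
Hypothesis hnu : forall n : nat, lambda <= n%:R ->
  stationary p lambda (num_particles rho n) (nu n).

Lemma mean_tau_small (e : R) : 0 < e -> \forall n \near \oo,
  stationary p lambda (num_particles rho n) (nu n) /\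
  0 <= mean (nu n) scaled_tau <= e.
Proof.
move=> e0; have [K K0 bounded] := mean_blocked_bounded hp hlambda hrho hnu.
near=> n; have [n0 ln stat meanK] : [/\ (0 < n)%N, lambda <= n%:R,
    stationary p lambda (num_particles rho n) (nu n) &
    mean (nu n) (fun A => #|blocked A|%:R) <= K] by near: n.
have nR : 0 < n%:R :> R by rewrite ltr0n.
split => //; apply/andP; split.
  rewrite -(mean_cst 0 stat); apply: mean_le stat _ => A _; exact: scaled_tau_ge0.
apply: (@le_trans _ _ (n%:R^-1 * mean (nu n) (fun A => #|blocked A|%:R))).
  by rewrite -meanZ; apply: mean_le stat _ => A _; rewrite mulrC scaled_tau_le.
have Ke : K / e <= n%:R by near: n; exact: nbhs_infty_ger.
by rewrite mulrC ler_pdivrMr //; move: Ke; rewrite ler_pdivrMr //; lra.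
Unshelve. all: by end_near.
Qed.

Lemma mean_tau_cvg : mean (nu n) scaled_tau @[n --> \oo] --> (0 : R).
Proof.
apply/cvgrPdist_le => e e0; apply: filterS (mean_tau_small e0) => n [_ /andP[t0 te]].
by rewrite sub0r normrN ger0_norm.
Qed.

(** On x >= 0 a bounded continuous g differs from g 0 by at most e / 2 + c x, so convergence of the
    mean of tau suffices. *)
Lemma tau_cvg_in_law :
  cvg_in_law (X := R) id nu (fun n A => scaled_tau A) \d_(0 : borelType R).
Proof.
move=> g cg [M gM].
have -> : Rintegral \d_(0 : borelType R) setT g = g 0.
  rewrite /Rintegral integral_dirac //; last exact: borel_measurable_EFin.
  by rewrite diracT mul1e.
apply/cvgrPdist_le => e e0.
have M0 : 0 <= M by apply: le_trans (gM 0).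
have e20 : 0 < e / 2 by rewrite divr_gt0.
have [d /= d0 gd] : nbhs_ball (0 : R) [set x | `|g 0 - g x| < e / 2].
  by apply/nbhs_ballP; move/cvgrPdist_lt: (cg 0); apply.
(* Makes c x >= 2 M beyond the radius d. *)
pose c := 2 * M / d.
have c0 : 0 <= c by rewrite divr_ge0 ?mulr_ge0 // ltW.
have gc x : 0 <= x -> `|g 0 - g x| <= e / 2 + c * x.
  move=> x0; have [xd|dx] := ltP x d.
    apply: ler_wpDr; first by rewrite mulr_ge0.
    by apply/ltW/gd; rewrite /ball /= sub0r normrN ger0_norm.
  apply: ler_wpDl; first exact: ltW.
  apply: le_trans (ler_normB _ _) _; apply: le_trans (lerD (gM _) (gM _)) _.
  have -> : M + M = c * d by rewrite /c divfK ?gt_eqF // mulr_natl mulr2n.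
  by rewrite ler_wpM2l.
have small0 : 0 < e / 2 / (c + 1) by rewrite divr_gt0 // ltr_wpDl.
apply: filterS (mean_tau_small small0) => n [stat /andP[t0 te]].
have ct : c * mean (nu n) scaled_tau <= e / 2.
  have := ler_wpM2l c0 te; move/le_trans; apply.
  rewrite mulrA ler_pdivrMr ?ltr_wpDl // mulrC ler_wpM2l ?lerDl // ltW //.
have bound : mean (nu n) (fun A => e / 2 + c * scaled_tau A) <= e.
  by rewrite meanD (mean_cst _ stat) meanZ; lra.
rewrite ler_norml /=.
have gcA (A : config n) := gc _ (scaled_tau_ge0 R A).
have lower : mean (nu n) (fun A => g (scaled_tau A)) <=
    mean (nu n) (fun A => g 0 + (e / 2 + c * scaled_tau A)).
  by apply: mean_le stat _ => A _; have := gcA A; rewrite ler_norml => /andP[]; lra.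
have upper : g 0 <= mean (nu n) (fun A => g (scaled_tau A) + (e / 2 + c * scaled_tau A)).
  rewrite -(mean_cst (g 0) stat); apply: mean_le stat _ => A _.
  by have := gcA A; rewrite ler_norml => /andP[]; lra.
move: lower upper; rewrite [X in _ <= X -> _]meanD (mean_cst _ stat) meanD.
by move=> *; apply/andP; split; lra.
Qed.

Lemma flux_cvg : flux p lambda (nu n) @[n --> \oo] --> rho.
Proof.
have [K K0 bounded] := mean_blocked_bounded hp hlambda hrho hnu.
apply/cvgrPdist_le => e e0; near=> n.
have [n0 ln stat meanK] : [/\ (0 < n)%N, lambda <= n%:R,
    stationary p lambda (num_particles rho n) (nu n) &
    mean (nu n) (fun A => #|blocked A|%:R) <= K] by near: n.
have nR : 0 < n%:R :> R by rewrite ltr0n.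
have p01 : 0 <= p <= 1 by have /andP[p0 ->] := hp; rewrite ltW.
have l0n : 0 <= lambda <= n%:R by rewrite ln ltW.
(* The errors are lambda from perturbations, 2 K from blocked particles and 1 from the ceiling. *)
have large : (lambda + 2 * K + 1) / e <= n%:R by near: n; exact: nbhs_infty_ger.
rewrite ler_pdivrMr // in large.
have /andP[lo hi] := flux_bounds p01 n0 l0n stat.
have /andP[klo khi] := num_particles_bounds hrho n.
rewrite ler_pdivrMr // in lo; rewrite ler_pdivlMr // in hi.
rewrite ler_norml; apply/andP; split; rewrite -(ler_pM2r nR); lra.
Unshelve. all: by end_near.
Qed.

Section Subsequence.
Variable s : nat -> nat.
Hypothesis hs : {homo s : i j / (i < j)%N}.

Lemma limit_integral_le (X : ptopologicalType) (F : forall n, config n -> X)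
    (mu : probability (borelType X) R) (g : X -> R) (l : R) :
  cvg_in_law s nu F mu -> continuous g -> (forall x, 0 <= g x <= 1) ->
  (\forall n \near \oo, mean (nu n) (fun A => g (F n A)) <= l) ->
  Rintegral mu setT g <= l.
Proof.
move=> cvg_mu cg g01 le_l.
have g1 : exists M, forall x, `|g x| <= M.
  by exists 1 => x; have /andP[g0 ?] := g01 x; rewrite ger0_norm.
apply: (ler_cvg_to (cvg_mu g cg g1) (cvg_cst l)).
exact: (near_subseq hs le_l).
Qed.

(** The test function min (|tau|, 1) has integral 0 in the limit. A general [X] lets the argument
    serve both state spaces. *)
Lemma limit_tau_negligible (X : ptopologicalType) (F : forall n, config n -> X)
    (mu : probability (borelType X) R) (tau : X -> R) :
  cvg_in_law s nu F mu -> continuous tau ->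
  (forall n A, tau (F n A) = scaled_tau A) ->
  mu.-negligible [set x | tau x <> 0].
Proof.
move=> cvg_mu ctau tauF.
pose g x := Num.min `|tau x| 1.
have cg : continuous g.
  move=> x; apply: (@continuous_min R X (fun x => `|tau x|) (fun=> 1)).
    by apply: continuous_comp; [exact: ctau | exact: norm_continuous].
  exact: cvg_cst.
have g01 x : 0 <= g x <= 1 by rewrite le_min normr_ge0 ler01 ge_min lexx orbT.
have int0 : \int[mu]_x g x = 0.
  apply/eqP; rewrite eq_le; apply/andP; split; last first.
    by apply: Rintegral_ge0 => x _; case/andP: (g01 x).
  apply/ler_addgt0Pr => e e0; rewrite add0r; apply: limit_integral_le cvg_mu cg g01 _.
  apply: filterS (mean_tau_small e0) => n [stat /andP[_]]; apply: le_trans.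
  apply: mean_le stat _ => A _; rewrite /g tauF ge_min ger0_norm ?lexx //.
  exact: scaled_tau_ge0.
have : (\int[mu]_(x in setT) `|(g x)%:E| = 0)%E.
  under eq_integral => x _ do rewrite gee0_abs ?lee_fin ?(andP (g01 x)).1 //.
  by rewrite integral_test // int0.
move/(ae_eq_integral_abs mu measurableT (borel_measurable_EFin cg)).
apply: negligibleS => x /= tau0 /(_ I)[]; rewrite /g.
move/eqP; rewrite minEle; case: ifP => _; last by rewrite oner_eq0.
by rewrite normr_eq0 => /eqP.
Qed.

(** Markov's inequality in the limit: the mean number of clusters is at most K, so +oo has mass at
    most K / L for every large L. *)
Lemma limit_num_clusters_negligible (X : ptopologicalType)
    (F : forall n, config n -> X) (mu : probability (borelType X) R)
    (num : X -> \bar R) :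
  cvg_in_law s nu F mu -> continuous num ->
  (forall n A, num (F n A) = num_clusters A) ->
  mu.-negligible [set x | num x = +oo%E].
Proof.
move=> cvg_mu cnum numF.
have cc : continuous (fun x => contract (num x)).
  by move=> x; apply: continuous_comp; [exact: cnum | exact: contract_continuous].
apply: negligible_test => [|e e0].
  have := borel_measurable_continuous cc measurableT (measurable_set1 1).
  rewrite setTI; congr measurable; apply/seteqP; split => x /=.
    by move/eqP; rewrite contract_eq1 => /eqP.
  by move=> ->.
have [K K0 bounded] := mean_blocked_bounded hp hlambda hrho hnu.
pose L := K / e + 1.
have L1 : 1 <= L by rewrite lerDr divr_ge0 // ltW.
(* [g] is 1 at +oo and at most [r / L] at a finite [r >= 0]. *)
pose g x := Num.max 0 (1 - L * (1 - contract (num x))).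
have cg : continuous g.
  move=> x; apply: (@continuous_max R X (fun=> 0) (fun x => 1 - L * (1 - contract (num x)))).
    exact: cvg_cst.
  apply: cvgB; first exact: cvg_cst.
  by apply: cvgM; [exact: cvg_cst | apply: cvgB; [exact: cvg_cst | exact: cc]].
have g01 x : 0 <= g x <= 1.
  rewrite le_max lexx /= ge_max ler01 lerBlDr lerDl mulr_ge0 //; first by lra.
  by have := contract_le1 (num x); rewrite ler_norml => /andP[_]; lra.
exists g; split => //.
  by move=> x /= numx; rewrite /g numx /= subrr mulr0 subr0; apply/max_idPr.
apply: limit_integral_le cvg_mu cg g01 _.
apply: filterS bounded => n [n0 _ stat meanK].
apply: (@le_trans _ _ (L^-1 * mean (nu n) (fun A => #|blocked A|%:R))).
  rewrite -meanZ; apply: mean_le stat _ => A _; rewrite /g numF /num_clusters.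
  set r : R := #|clusters A|%:R; have r0 : 0 <= r by [].
  have rb : r <= #|blocked A|%:R by rewrite ler_nat card_clusters.
  apply: (@le_trans _ _ (L^-1 * r)); last by rewrite ler_wpM2l // invr_ge0; lra.
  rewrite ge_max mulr_ge0 ?invr_ge0 //=; last by lra.
  have L0 : 0 < L by lra.
  have r10 : 0 < 1 + r by lra.
  rewrite ger0_norm // [leRHS]mulrC ler_pdivlMr //.
  have -> : 1 - r / (1 + r) = (1 + r)^-1 by field; rewrite gt_eqF.
  suff : (1 - L / (1 + r)) * L * (1 + r) <= r * (1 + r) by rewrite ler_pM2r.
  have -> : (1 - L / (1 + r)) * L * (1 + r) = L * (1 + r - L) by field; rewrite gt_eqF.
  (* Four times the difference is (2r + 1 - L)^2 + (3L + 1)(L - 1), and L >= 1. *)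
  have := sqr_ge0 (2 * r + 1 - L); nra.
rewrite mulrC ler_pdivrMr; last by lra.
apply: le_trans meanK _; rewrite /L mulrDr mulr1 mulrCA mulfV ?gt_eqF //; lra.
Qed.

End Subsequence.
End Limits.

Theorem theorem17 (R : realType) (p lambda rho : R)
    (nu : forall n : nat, config n -> R)
    (hp : 0 < p <= 1) (hlambda : 0 < lambda) (hrho : 0 < rho < p / (1 + p))
    (hnu : forall n : nat, lambda <= n%:R ->
       stationary p lambda (num_particles rho n) (nu n)) :
  [/\ forall (s : nat -> nat) (mu : probability (borelType (state_space R)) R),
        {homo s : i j / (i < j)%N} ->
        cvg_in_law s nu (scaled_state rho) mu ->
        {ae mu, forall x : state_space R, x.2 = 0},
      forall (s : nat -> nat)
          (mu : probability (borelType (counted_state_space R)) R),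
        {homo s : i j / (i < j)%N} ->
        cvg_in_law s nu (counted_state rho) mu ->
        {ae mu, forall x : counted_state_space R,
           x.1.2 = 0 /\ (x.2 < +oo)%E},
      cvg_in_law (X := R) id nu (fun n A => scaled_tau A) \d_(0 : borelType R),
      mean (nu n) scaled_tau @[n --> \oo] --> (0 : R)
    & flux p lambda (nu n) @[n --> \oo] --> rho].
Proof.
split.
- move=> s mu hs cvg_mu.
  apply: (limit_tau_negligible hp hlambda hrho hnu hs cvg_mu (tau := snd)) => //.
  by move=> x; exact: cvg_snd.
- move=> s mu hs cvg_mu.
  have c1 : continuous (fun x : counted_state_space R => x.1.2).
    by move=> x; apply: continuous_comp; [exact: cvg_fst | exact: cvg_snd].
  have c2 : continuous (fun x : counted_state_space R => x.2).
    by move=> x; exact: cvg_snd.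
  have tau0 := limit_tau_negligible hp hlambda hrho hnu hs cvg_mu c1 (fun _ _ => erefl).
  have num0 := limit_num_clusters_negligible hp hlambda hrho hnu hs cvg_mu c2
    (fun _ _ => erefl).
  apply: negligibleS (negligibleU tau0 num0) => x /= fails.
  have [x12|] := pselect (x.1.2 = 0); last by left.
  by right; apply: contra_notP fails => /eqP x2; rewrite ltey.
- exact: tau_cvg_in_law hp hlambda hrho hnu.
- exact: mean_tau_cvg hp hlambda hrho hnu.
- exact: flux_cvg hp hlambda hrho hnu.
Qed.
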